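(* Let $\mathbb{D}=(D,\mathcal{X})$ be a linear space such that there is an integer $q\ge 3$ with $|D|=q^2$, $|\mathcal{X}_p|\le q+1$ for each $p\in D$, and $|D_X|\le q+1$ for each $X\in\mathcal{X}$. Then $\mathbb{D}$ is obtained by deleting $q+1$ points from a projective plane of order $q$. Explicitly, one of the following cases occurs: (a) There is no line $X\in\mathcal{X}$ with $|D_X|=q+1$, and $\mathbb{D}$ is an affine plane of order $q$, with $|\mathcal{X}|=q^2+q$. (b) There exists a point $u\in D$ with $|\mathcal{X}_u|\le q$, and $\mathbb{D}$ is obtained from a projective plane $\mathbb{P}=(P,\mathcal{L})$ of order $q$ by deleting some line $W$ from $\mathcal{L}$ and deleting the point set $(P_W\setminus\{u\})\cup\{v\}$ from $P$, where $u$ is some point on $W$ and $v$ is some point of $P\setminus P_W$ (the lines of $\mathbb{D}$ being the lines of $\mathbb{P}$ other than $W$, with induced incidence); moreover $|\mathcal{X}|=q^2+q$, $|\mathcal{X}_u|=q$, and $|\mathcal{X}_p|=q+1$ for each $p\in D\setminus\{u\}$. (c) We have $|\mathcal{X}|=q^2+q+1$ and $|\mathcal{X}_p|=q+1$ for each $p\in D$. In this case $\mathbb{D}$ is obtained from a projective plane $\mathbb{P}=(P,\mathcal{L})$ of order $q$ by deleting a set $Y$ of $q+1$ points such that no $q$ of them are collinear (with $\mathcal{X}=\mathcal{L}$ and induced incidence), and for each $y\in Y$ there exists a line $X_y\in\mathcal{L}$ through $y$ such that $|D_{X_y}|=q$.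
   Context: A linear space is an incidence geometry $(D,\mathcal{X},I)$ with point set $D$, line set $\mathcal{X}$ and incidence relation $I\subseteq D\times\mathcal{X}$ such that any two distinct points are incident with exactly one common line, and each line is incident with at least two points. For $p\in D$, $\mathcal{X}_p$ is the set of lines incident with $p$; for a line $X$, $D_X$ is the set of points of $D$ incident with $X$ (for a projective plane $\mathbb{P}=(P,\mathcal{L})$ and a line $W$, $P_W$ is the set of points of $\mathbb{P}$ on $W$). ''Obtained by deleting points from a projective plane'' means: the points of $\mathbb{D}$ are the remaining points, the lines of $\mathbb{D}$ are (identified with) lines of the plane containing at least two remaining points, and incidence is the induced one. *)

(* Defs.v *)
From mathcomp Require Import all_boot.

Set Implicit Arguments.
Unset Strict Implicit.
Unset Printing Implicit Defensive.

Record geometry := Geometry {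
  point : finType;
  line : finType;
  inc : point -> line -> bool
}.

Definition lines_through (G : geometry) (p : point G) : {set line G} :=
  [set X | inc p X].

Definition points_on (G : geometry) (X : line G) : {set point G} :=
  [set p | inc p X].

Definition collinear (G : geometry) (A : {set point G}) : Prop :=
  exists X : line G, A \subset points_on X.

Definition no_k_collinear (G : geometry) (k : nat) (Y : {set point G}) : Prop :=
  forall A : {set point G}, A \subset Y -> #|A| = k -> ~ collinear A.

Definition linear_space (G : geometry) : Prop :=
  (forall p p' : point G, p <> p' -> exists! X : line G, inc p X /\ inc p' X)
  /\ (forall X : line G, 2 <= #|points_on X|).

Definition projective_plane (G : geometry) : Prop :=
  [/\ linear_space G,
      forall X X' : line G, X <> X' ->
        exists! p : point G, inc p X /\ inc p X'
    & exists Q : {set point G}, #|Q| = 4 /\ no_k_collinear 3 Q].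

Definition projective_plane_of_order (q : nat) (G : geometry) : Prop :=
  projective_plane G /\ forall X : line G, #|points_on X| = q.+1.

Definition affine_plane (G : geometry) : Prop :=
  [/\ linear_space G,
      forall (p : point G) (X : line G), ~~ inc p X ->
        exists! X' : line G, inc p X' /\ [disjoint points_on X & points_on X']
    & exists T : {set point G}, #|T| = 3 /\ ~ collinear T].

Definition affine_plane_of_order (q : nat) (G : geometry) : Prop :=
  affine_plane G /\ forall X : line G, #|points_on X| = q.

(* The maps f and g identify D with the geometry induced by P on the point set
   A and the line set B. *)
Definition identifies (D P : geometry)
    (f : point D -> point P) (g : line D -> line P)
    (A : {set point P}) (B : {set line P}) : Prop :=
  [/\ injective f /\ [set f p | p : point D] = A,
      injective g /\ [set g X | X : line D] = B
    & forall (p : point D) (X : line D), inc p X = inc (f p) (g X)].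

Definition obtained_by_deleting (D P : geometry) (Y : {set point P}) : Prop :=
  exists (f : point D -> point P) (g : line D -> line P),
    identifies f g (~: Y) [set L | 2 <= #|points_on L :\: Y|].

Definition case_a (q : nat) (D : geometry) : Prop :=
  [/\ ~ (exists X : line D, #|points_on X| = q.+1),
      affine_plane_of_order q D
    & #|line D| = q ^ 2 + q].

(* The point u of D and the point of P on W that survives the deletion are the
   same point: the latter is f u. *)
Definition case_b (q : nat) (D : geometry) : Prop :=
  exists u : point D,
  [/\ #|lines_through u| <= q,
      exists (P : geometry) (W : line P) (v : point P)
             (f : point D -> point P) (g : line D -> line P),
        [/\ projective_plane_of_order q P,
            inc (f u) W,
            ~~ inc v W
          & identifies f g
              (~: ((points_on W :\ f u) :|: [set v])) [set~ W]],
      #|line D| = q ^ 2 + q,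
      #|lines_through u| = q
    & forall p : point D, p <> u -> #|lines_through p| = q.+1].

(* In the last clause g X is the line X_y of P; its points belonging to D are
   the points of D on X. *)
Definition case_c (q : nat) (D : geometry) : Prop :=
  [/\ #|line D| = q ^ 2 + q + 1,
      forall p : point D, #|lines_through p| = q.+1
    & exists (P : geometry) (Y : {set point P})
             (f : point D -> point P) (g : line D -> line P),
        [/\ projective_plane_of_order q P,
            #|Y| = q.+1,
            no_k_collinear q Y,
            identifies f g (~: Y) [set: line P]
          & forall y : point P, y \in Y ->
              exists X : line D, inc y (g X) /\ #|points_on X| = q]].

(* Main.v *)
(* Add to D an empty line if D is an affine plane, the line {u} if some point u
   has fewer than q + 1 lines, and nothing otherwise. Then every point is on
   q + 1 lines and there are q^2 + q + 1 lines. As long as some line has at most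
   q points, some line X has exactly q points; the q lines disjoint from X are
   then pairwise disjoint, so together with X they partition the points, and
   these q + 1 lines can be made to meet in a new point. Lines are never changed
   in this process, which stops at a projective plane. *)
Require Import Defs.
From mathcomp Require Import all_boot zify.

Set Implicit Arguments.
Unset Strict Implicit.
Unset Printing Implicit Defensive.

(** * Double counting with unique joining lines *)

Definition joined (G : geometry) : Prop :=
  forall p p' : point G, p != p' -> #|lines_through p :&: lines_through p'| = 1.

(** The condition [Z != X] matters only for a line without points, which is disjoint from itself. *)
Definition parallels (G : geometry) (X : line G) : {set line G} :=
  [set Z | (Z != X) && [disjoint points_on X & points_on Z]].

Lemma joinedP (G : geometry) :
  joined G <->
  (forall p p' : point G, p <> p' -> exists! X : line G, inc p X /\ inc p' X).
Proof.
split=> h p p'.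
  move=> /eqP/h /eqP/cards1P[X /setP eX]; exists X; split.
    by move: (eX X); rewrite !inE eqxx => /andP.
  by move=> Z [h1 h2]; move: (eX Z); rewrite !inE h1 h2 => /esym/eqP.
move=> /eqP/h [X [[h1 h2] hu]]; apply/eqP/cards1P; exists X; apply/setP=> Z.
rewrite !inE; apply/andP/eqP => [/hu //|->]; by [].
Qed.

Lemma flag_count (G : geometry) (A : {set point G}) (B : {set line G}) :
  \sum_(X in B) #|A :&: points_on X| = \sum_(p in A) #|B :&: lines_through p|.
Proof.
under eq_bigr => X _ do rewrite -sum1_card big_mkcond /=.
under [RHS]eq_bigr => X _ do rewrite -sum1_card big_mkcond /=.
rewrite big_mkcond [RHS]big_mkcond /=.
have e1 X : (if X \in B then \sum_i (if i \in A :&: points_on X then 1 else 0)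
     else 0) = \sum_i (if [&& X \in B, i \in A & inc i X] then 1 else 0).
  by case: (X \in B); [apply: eq_bigr => i _; rewrite !inE | rewrite big1].
have e2 p : (if p \in A then
     \sum_i (if i \in B :&: lines_through p then 1 else 0)
     else 0) = \sum_i (if [&& i \in B, p \in A & inc p i] then 1 else 0).
  case: (p \in A); first by apply: eq_bigr => i _; rewrite !inE.
  by rewrite big1 // => i _; rewrite andbF.
under eq_bigr do rewrite e1.
under [RHS]eq_bigr do rewrite e2.
by rewrite exchange_big.
Qed.

Section Joined.

Variables (G : geometry) (hJ : joined G).

Lemma line_eq (p p' : point G) (X Z : line G) :
  p != p' -> inc p X -> inc p' X -> inc p Z -> inc p' Z -> X = Z.
Proof.
move=> /hJ /eqP/cards1P[Y /setP eY] h1 h2 h3 h4.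
move: (eY X) (eY Z); rewrite !inE h1 h2 h3 h4.
by move=> /esym/eqP-> /esym/eqP->.
Qed.

Lemma card_meet_le1 (X Z : line G) :
  X != Z -> #|points_on X :&: points_on Z| <= 1.
Proof.
move=> nXZ; apply/card_le1_eqP => p p'; rewrite !inE.
move=> /andP[h1 h2] /andP[h3 h4]; apply/eqP; apply: contraNT nXZ => npp'.
exact/eqP/(line_eq npp').
Qed.

(** Each line of [B] differs from [X], so it meets [X] in one point and is counted once in the sum,
    or in none and is counted among the parallels. *)
Lemma card_parallels_in (X : line G) (B : {set line G}) :
  X \notin B ->
  \sum_(p in points_on X) #|B :&: lines_through p|
    + #|B :&: parallels X| = #|B|.
Proof.
move=> XB; rewrite -flag_count -!sum1_card.
rewrite [X in _ + X](eq_bigl (fun Z => (Z \in B) && (Z \in parallels X)));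
  last by move=> Z; rewrite !inE.
rewrite big_mkcondr /= -big_split /=; apply: eq_bigr => Z ZB.
have nZX : Z != X by apply: contraNneq XB => <-.
have := card_meet_le1 nZX; rewrite setIC inE nZX /= -setI_eq0 -cards_eq0.
by case: #|_| => [|[]].
Qed.

(** The lines through [p] that meet [X] correspond to the points of [X], each joined to [p] by one
    line. *)
Lemma card_parallels_at (p : point G) (X : line G) :
  ~~ inc p X ->
  #|points_on X| + #|lines_through p :&: parallels X| = #|lines_through p|.
Proof.
move=> npX; rewrite -(@card_parallels_in X (lines_through p)) ?inE //.
congr (_ + _).
rewrite -sum1_card; apply: eq_bigr => p'; rewrite inE => p'X.
by rewrite hJ //; apply: contraNneq npX => ->.
Qed.

(** The lines through [p] partition the points other than [p]. *)
Lemma card_other_points (p : point G) :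
  \sum_(X in lines_through p) #|points_on X|.-1 = #|point G|.-1.
Proof.
transitivity (\sum_(X in lines_through p) #|[set~ p] :&: points_on X|).
  apply: eq_bigr => X; rewrite inE => pX.
  by rewrite [in LHS](cardsD1 p) inE pX /= setDE setIC.
rewrite flag_count -[#|point G|]cardsT (cardsD1 p) inE /= setTD.
rewrite -[RHS]sum1_card.
by apply: eq_bigr => p'; rewrite !inE => np; rewrite hJ // eq_sym.
Qed.

End Joined.

(** * Near-planes and their parallel lines *)

(* Lines of a near-plane may have fewer than two points, even none. *)
Definition near_plane (q : nat) (G : geometry) : Prop :=
  [/\ joined G,
      forall p : point G, #|lines_through p| = q.+1,
      #|line G| = q ^ 2 + q + 1,
      forall X : line G, #|points_on X| <= q.+1
    & q ^ 2 <= #|point G|].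

(** Among the lines other than [X], each point of [X] is on [q], and those missing [X] are its
    parallels. *)
Lemma card_lines_parallels (q : nat) (G : geometry) (X : line G) :
  joined G -> (forall p : point G, #|lines_through p| = q.+1) ->
  #|line G| = (#|points_on X| * q + #|parallels X|).+1.
Proof.
move=> hJ hd; rewrite -cardsT (cardsD1 X) inE setTD add1n; congr _.+1.
rewrite -(@card_parallels_in _ hJ X [set~ X]) ?inE ?eqxx //; congr (_ + _).
  rewrite -sum_nat_const; apply: eq_bigr => p; rewrite inE => pX.
  by rewrite setIC -setDE; move: (hd p); rewrite (cardsD1 X) inE pX => -[].
by congr #|pred_of_set _|; apply/setP => Z; rewrite !inE; case: (Z != X).
Qed.

Lemma parallels_sym (G : geometry) (X Z : line G) :
  (Z \in parallels X) = (X \in parallels Z).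
Proof. by rewrite !inE eq_sym disjoint_sym. Qed.

Section NearPlane.

Variables (q : nat) (G : geometry) (hG : near_plane q G).

Lemma card_parallels (X : line G) :
  #|parallels X| = (q.+1 - #|points_on X|) * q.
Proof.
case: hG => hJ hd hb hs _; have := card_lines_parallels X hJ hd.
by move: (hs X); rewrite hb; nia.
Qed.

Lemma card_parallels_through (p : point G) (X : line G) :
  ~~ inc p X -> #|lines_through p :&: parallels X| = q.+1 - #|points_on X|.
Proof.
by case: hG => hJ hd _ _ _ /(card_parallels_at hJ); rewrite hd; lia.
Qed.

Lemma full_no_parallel (X Z : line G) :
  #|points_on X| = q.+1 -> Z \notin parallels X.
Proof.
move=> hX; apply: contraT; rewrite negbK => ZX.
move: (card_parallels X); rewrite hX subnn mul0n => /cards0_eq e.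
by rewrite e inE in ZX.
Qed.

(* If the line [X] of size [k <= q - 1] and all its [(q + 1 - k) q] parallels had
   size at most [q - 1], then counting the flags formed by a parallel of [X] and
   one of its points gives [(v - k) (q + 1 - k) <= (q + 1 - k) q (q - 1)], which
   contradicts [v >= q ^ 2]. *)
Lemma exists_line_size_q (X : line G) :
  #|points_on X| <= q -> exists Z : line G, #|points_on Z| = q.
Proof.
case: (hG) => hJ hd hb hs hv kq.
case: (pickP (fun Z : line G => #|points_on Z| == q)) => [Z /eqP|hno].
  by exists Z.
exfalso.
have small Z : Z \in parallels X -> #|points_on Z| <= q.-1.
  move=> ZX; have := hs Z; rewrite leq_eqVlt => /orP[/eqP full|].
    by move: (full_no_parallel X full); rewrite -parallels_sym ZX.
  by rewrite ltnS leq_eqVlt (hno Z) /=; lia.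
have := flag_count (~: points_on X) (parallels X).
rewrite [RHS](eq_bigr (fun=> q.+1 - #|points_on X|)); last first.
  by move=> p; rewrite !inE => pX; rewrite setIC card_parallels_through.
rewrite sum_nat_const => eq_flags.
have : \sum_(Z in parallels X) #|~: points_on X :&: points_on Z|
       <= \sum_(Z in parallels X) q.-1.
  apply: leq_sum => Z /small; apply: leq_trans.
  exact/subset_leq_card/subsetIr.
rewrite eq_flags sum_nat_const card_parallels //.
rewrite -[#|~: _|](addKn #|points_on X|) cardsC.
have : #|points_on X| < q by have := hno X; lia.
move: (#|points_on X|) (#|point G|) hv => k v hv kltq.
rewrite mulnC -mulnA leq_pmul2l; last by lia.
nia.
Qed.

End NearPlane.

(** * Completing a near-plane by new points *)

Definition add_point (G : geometry) (C : {set line G}) : geometry :=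
  Geometry (fun (p : option (point G)) X =>
    if p is Some p' then inc p' X else X \in C).

Lemma card_option_set (T : finType) (A : {set option T}) :
  #|A| = #|[set x | Some x \in A]| + (None \in A).
Proof.
rewrite (cardsD1 None) addnC; congr (_ + _).
rewrite -(card_imset (mem [set x | Some x \in A]) (@Some_inj _)).
congr #|pred_of_set _|; apply/setP => -[x|]; rewrite !inE /=.
  by rewrite mem_imset ?inE //; exact: Some_inj.
by symmetry; apply/imsetP => -[].
Qed.

(** The class [C] has [q + 1] lines and covers every old point exactly once. Hence the new point has
    the right degree and is joined to each old point by one line. *)
Lemma near_plane_add_point (q : nat) (G : geometry) (X : line G) :
  near_plane q G -> #|points_on X| = q ->
  near_plane q (add_point (X |: parallels X)).
Proof.
move=> hG hX; case: (hG) => hJ hd hb hs hv; set C := X |: _.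
have cardC : #|C| = q.+1.
  by rewrite cardsU1 (card_parallels hG) hX inE eqxx; lia.
(* On a point of [X] the parallels do not pass; off [X] there are [q + 1 - q = 1] parallels through
   [p]. *)
have class_at p : #|lines_through p :&: C| = 1.
  have [pX|pX] := boolP (inc p X).
    apply/eqP/cards1P; exists X; apply/setP => Z; rewrite !inE.
    have [->|nZX] := eqVneq Z X; first by rewrite pX.
    have [pZ|] //= := boolP (inc p Z).
    by apply/negP => /pred0P/(_ p); rewrite /= !inE pX pZ.
  rewrite setIUr (_ : _ :&: [set X] = set0) ?set0U.
    by rewrite (card_parallels_through hG) // hX; lia.
  apply/setP => Z; rewrite !inE; case: eqP => [->|]; rewrite ?andbF ?andbT //.
  exact: negPf.
have lines_some p : @lines_through (add_point C) (Some p) = lines_through p.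
  by apply/setP => Z; rewrite !inE.
have lines_none : @lines_through (add_point C) None = C.
  by apply/setP => Z; rewrite inE.
split=> /=.
- move=> [p|] [p'|] //; rewrite ?lines_some ?lines_none => npp'.
  + exact: hJ.
  + exact: class_at.
  + by rewrite setIC class_at.
- by move=> [p|]; rewrite ?lines_some ?lines_none.
- exact: hb.
- move=> Z; rewrite card_option_set.
  rewrite [X in X + _](_ : _ = #|points_on Z|); last first.
    by congr #|pred_of_set _|; apply/setP => p; rewrite !inE.
  rewrite inE /=; case ZC : (Z \in C); last by rewrite addn0.
  (* A line that gains the new point must have had at most [q] points: a parallel of [X] is not
     full, since a full line has no parallels. *)
  move: ZC; rewrite addn1 ltnS => /setU1P[->|ZX]; first by rewrite hX.
  have := hs Z; rewrite leq_eqVlt => /orP[/eqP full|//].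
  by move: (full_no_parallel hG X full); rewrite -parallels_sym ZX.
- by rewrite card_option; lia.
Qed.

Lemma near_plane_card_points_le (q : nat) (G : geometry) :
  near_plane q G -> #|point G| <= q ^ 2 + q + 1.
Proof.
case=> hJ hd _ hs _; case: (pickP (point G)) => [p _|/eq_card0 ->] //.
have : #|point G|.-1 <= \sum_(X in lines_through p) q.
  rewrite -(card_other_points hJ p); apply: leq_sum => X _.
  by have := hs X; lia.
by rewrite sum_nat_const hd; nia.
Qed.

Lemma near_plane_card_points (q : nat) (G : geometry) :
  0 < q -> near_plane q G -> (forall X : line G, #|points_on X| = q.+1) ->
  #|point G| = q ^ 2 + q + 1.
Proof.
move=> q0 [hJ hd _ _ hv] full.
have /card_gt0P[p _] : 0 < #|point G|.
  by apply: leq_trans hv; rewrite expn_gt0 q0.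
have : \sum_(X in lines_through p) q = #|point G|.-1.
  by rewrite -(card_other_points hJ p); apply: eq_bigr => X _; rewrite full.
by rewrite sum_nat_const hd; nia.
Qed.

(** Induction on the number of missing points. Since [add_point] keeps the line type, no map on
    lines is needed. *)
Lemma near_plane_completion (q : nat) (G : geometry) :
  near_plane q G ->
  exists (T : finType) (i : T -> line G -> bool) (f : point G -> T),
    [/\ near_plane q (Geometry i),
        forall X : line G, #|@points_on (Geometry i) X| = q.+1,
        injective f
      & forall p X, inc p X = i (f p) X].
Proof.
(* A near-plane has at most [q ^ 2 + q + 1] points, so with the constant 2 the truncated difference
   is positive and drops with each added point. *)
have [n] := ubnP (q ^ 2 + q + 2 - #|point G|).
elim: n G => // n IHn G; rewrite ltnS => hn hG.
case: (pickP (fun X : line G => #|points_on X| <= q)) 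
  => [X hX|full]; last first.
  exists (point G), (@inc G), id; split=> // X.
  have /negbT := full X; rewrite -ltnNge => hX.
  by apply/eqP; rewrite eqn_leq; case: hG => _ _ _ -> _.
have [Z /(near_plane_add_point hG) hG'] := exists_line_size_q hG hX.
case: (IHn _ _ hG') => [|T [i [f [hT full fI finc]]]].
  by rewrite /= card_option; have := near_plane_card_points_le hG; lia.
exists T, i, (f \o Some); split=> //; first by move=> p p' /fI [].
by move=> p X'; rewrite -finc.
Qed.

(** * Near-planes whose lines are all full *)

(** Full lines have no parallels, so any two lines meet. The quadrangle takes two points other than
    [o] on each of two lines through [o]. *)
Lemma full_near_plane_projective (q : nat) (P : geometry) :
  2 <= q -> near_plane q P -> (forall X : line P, #|points_on X| = q.+1) ->
  projective_plane_of_order q P.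
Proof.
move=> q2 hP full; case: (hP) => hJ hd hb hs hv; split=> //.
have meet (X X' : line P) : X != X' -> exists p, inc p X && inc p X'.
  move=> nXX'; move: (full_no_parallel hP X' (full X)).
  by rewrite inE eq_sym nXX' /= => /pred0Pn[p]; rewrite /= !inE; exists p.
split.
- split; first exact/joinedP.
  by move=> X; rewrite full; apply: leqW.
- move=> X X' /eqP nXX'; have [p /andP[pX pX']] := meet _ _ nXX'.
  exists p; split=> // p' [p'X p'X'].
  apply/eqP; apply: contraNT nXX' => npp'; exact/eqP/(line_eq hJ npp').
have /card_gt0P[o _] : 0 < #|point P|.
  by apply: leq_trans hv; rewrite expn_gt0; lia.
have /card_gt1P[X [X' [oX oX' nXX']]] : 1 < #|lines_through o|.
  by rewrite hd; lia.
move: oX oX'; rewrite !inE => oX oX'.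
have pair (Z : line P) : inc o Z ->
    exists A : {set point P}, [/\ #|A| = 2, A \subset points_on Z & o \notin A].
  move=> oZ; have : 1 < #|points_on Z :\ o|.
    by have := full Z; rewrite (cardsD1 o) inE oZ; lia.
  move=> /card_gt1P[a [a' [h1 h2 naa']]]; exists [set a; a'].
  move: h1 h2; rewrite !inE => /andP[na aZ] /andP[na' a'Z]; split.
  - by rewrite cards2 naa'.
  - by apply/subsetP => z; rewrite !inE => /orP[/eqP->|/eqP->].
  - by rewrite !(eq_sym o) negb_or na na'.
have [A [cA AX oA]] := pair X oX; have [A' [cA' AX' oA']] := pair X' oX'.
have only_o p : inc p X -> inc p X' -> p = o.
  move=> pX pX'; apply/eqP; apply: contraNT nXX' => npo.
  exact/eqP/(line_eq hJ npo).
have disj : [disjoint A & A'].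
  apply/pred0P => p; apply/negP => /andP[/= pA pA'].
  have po : p = o.
    by apply: only_o; [have := subsetP AX _ pA | have := subsetP AX' _ pA'];
      rewrite inE.
  by rewrite -po pA in oA.
exists (A :|: A'); split.
  by move: disj; rewrite -leq_card_setU => /eqP->; rewrite cA cA'.
(* A line other than [X] and [X'] has at most one point in each of [A], [A']. *)
move=> B /subsetP BQ cB [Z /subsetP BZ].
suff : #|(A :|: A') :&: points_on Z| <= 2.
  apply/negP; rewrite -ltnNge -cB; apply: subset_leq_card.
  by apply/subsetP => b bB; rewrite inE BQ ?BZ.
(* If [Z] is [X1], it contains no point of [A2], because [X1] and [X2] share only [o]. *)
have only_one (A1 A2 : {set point P}) (X1 X2 : line P) :
    #|A1| = 2 -> A2 \subset points_on X2 -> o \notin A2 ->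
    (forall p, inc p X1 -> inc p X2 -> p = o) -> Z = X1 ->
    #|(A1 :|: A2) :&: points_on Z| <= 2.
  move=> <- /subsetP A2X2 oA2 h ->; apply: subset_leq_card.
  apply/subsetP => p; rewrite !inE => /andP[/orP[//|pA2] pX1].
  have := A2X2 _ pA2; rewrite inE => /(h _ pX1) po.
  by rewrite -po pA2 in oA2.
have [eZ|nZX] := eqVneq Z X; first exact: (only_one _ _ X X').
have [eZ|nZX'] := eqVneq Z X'.
  by rewrite setUC; apply: (only_one _ _ X' X) => // p h1 h2; exact: only_o.
rewrite setIUl; apply: leq_trans (leq_card_setU _ _) _; rewrite -[2]/(1 + 1).
apply: leq_add.
  apply: leq_trans (card_meet_le1 hJ nZX); rewrite setIC.
  exact/subset_leq_card/setIS.
apply: leq_trans (card_meet_le1 hJ nZX'); rewrite setIC.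
exact/subset_leq_card/setIS.
Qed.

(** * Adding one line with at most one point *)

Definition add_line (G : geometry) (A : {set point G}) : geometry :=
  Geometry (fun p (X : option (line G)) =>
    if X is Some X' then inc p X' else p \in A).

Lemma points_on_add_line (G : geometry) (A : {set point G})
    (X : line (add_line A)) :
  points_on X = if X is Some X' then points_on X' else A.
Proof. by apply/setP => p; case: X => [X|]; rewrite !inE. Qed.

Lemma card_lines_through_add_line (G : geometry) (A : {set point G})
    (p : point (add_line A)) :
  #|lines_through p| = #|@lines_through G p| + (p \in A).
Proof.
rewrite card_option_set inE; congr (#|pred_of_set _| + _).
by apply/setP => X; rewrite !inE.
Qed.

Lemma joined_add_line (G : geometry) (A : {set point G}) :
  #|A| <= 1 -> joined G -> joined (add_line A).
Proof.
move=> /card_le1_eqP A1 hJ p p' npp'; rewrite card_option_set.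
rewrite (_ : None \in _ = false) ?addn0; last first.
  apply/negP; rewrite !inE => /andP[pA p'A].
  by rewrite (A1 _ _ pA p'A) eqxx in npp'.
rewrite -(hJ _ _ npp'); congr #|pred_of_set _|.
by apply/setP => X; rewrite !inE.
Qed.

(** A parallel of [L] would have a point [p] off [L], but the [q + 1] lines through [p] are used up
    by joining [p] to the points of [L]. So [L] has no parallels and the count is
    [(q + 1) * q + 1]. *)
Lemma full_line_card_lines (q : nat) (G : geometry) (L : line G) :
  joined G -> (forall p : point G, #|lines_through p| = q.+1) ->
  (forall X : line G, 0 < #|points_on X|) -> #|points_on L| = q.+1 ->
  #|line G| = q ^ 2 + q + 1.
Proof.
move=> hJ hd hne hL; rewrite (card_lines_parallels L hJ hd) hL.
suff -> : parallels L = set0 by rewrite cards0; lia.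
apply/setP => X; rewrite [RHS]inE; apply/negP => XL.
have /card_gt0P[p] := hne X; rewrite inE => pX.
have pL : ~~ inc p L.
  apply/negP => pL; move: XL; rewrite inE => /andP[_ /pred0P/(_ p)].
  by rewrite /= !inE pX pL.
have := card_parallels_at hJ pL; rewrite hL hd => /eqP.
rewrite -[X in _ == X]addn0 eqn_add2l => /eqP/cards0_eq/setP/(_ X).
by rewrite !inE pX; move: XL; rewrite inE => ->.
Qed.

(** * Deleting points from the completed plane *)

Section Embedding.

Variables (q : nat) (D P : geometry).
Variables (f : point D -> point P) (g : line D -> line P).
Hypotheses (q2 : 2 <= q) (hP : near_plane q P).
Hypothesis full : forall X : line P, #|points_on X| = q.+1.
Hypotheses (cD : #|point D| = q ^ 2) (fI : injective f) (gI : injective g).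
Hypothesis finc : forall (p : point D) (X : line D), inc p X = inc (f p) (g X).

Let Y : {set point P} := ~: [set f p | p : point D].

Lemma card_missing_points : #|Y| = q.+1.
Proof.
have := near_plane_card_points (ltnW q2) hP full.
rewrite -(cardsC [set f p | p : point D]) -/Y card_imset //.
by rewrite cD; lia.
Qed.

Lemma card_line_minus_missing (L : line P) :
  #|points_on L :\: Y| = #|[set p | inc (f p) L]|.
Proof.
rewrite -(card_imset _ fI); congr #|pred_of_set _|; apply/setP => x.
rewrite !inE negbK; apply/andP/imsetP => [[/imsetP[p _ ->] pL]|[p pL ->]].
  by exists p; rewrite ?inE.
by rewrite inE in pL; split=> //; apply: imset_f.
Qed.

Lemma card_line_image (X : line D) :
  #|points_on (g X) :\: Y| = #|points_on X|.
Proof.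
rewrite card_line_minus_missing; congr #|pred_of_set _|.
by apply/setP => p; rewrite !inE finc.
Qed.

(** The lines of [P] outside the image of [g] will be the added empty line or [{u}]. They keep at
    most one point, so the lines keeping two points are exactly those of [D]. *)
Lemma embedding_obtained :
  (forall X : line D, 2 <= #|points_on X|) ->
  (forall L : line P, L \notin codom g -> #|[set p | inc (f p) L]| <= 1) ->
  exists (P' : geometry) (Y' : {set point P'}),
    [/\ projective_plane_of_order q P', #|Y'| = q.+1
      & obtained_by_deleting D Y'].
Proof.
move=> h2 hsmall; exists P, Y; split; first exact: full_near_plane_projective.
  exact: card_missing_points.
exists f, g; split=> //; first by rewrite setCK.
split=> //; apply/setP => L; rewrite inE; apply/imsetP/idP => [[X _ ->]|hL].
  by rewrite card_line_image.
have [/codomP[X ->]|/hsmall] := boolP (L \in codom g); first by exists X.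
by rewrite -card_line_minus_missing leqNgt hL.
Qed.

End Embedding.

(** * Points on fewer than q + 1 lines *)

(** Each line through [p] covers at most [q] of the [q ^ 2 - 1] other points, and [(q - 1) * q] is
    too small. *)
Lemma card_lines_through_ge (q : nat) (D : geometry) (p : point D) :
  2 <= q -> joined D -> #|point D| = q ^ 2 ->
  (forall X : line D, #|points_on X| <= q.+1) -> q <= #|lines_through p|.
Proof.
move=> q2 hJ cD hs.
have : #|point D|.-1 <= \sum_(X in lines_through p) q.
  rewrite -(card_other_points hJ p); apply: leq_sum => X _.
  by have := hs X; lia.
by rewrite sum_nat_const cD; nia.
Qed.

(** The [q] lines through [u] could cover [q ^ 2] other points but cover [q ^ 2 - 1]. This slack of
    1 allows at most one line that is not full, which leaves [q - 1 >= 2] full ones. *)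
Lemma two_full_lines (q : nat) (D : geometry) (u : point D) :
  3 <= q -> joined D -> #|point D| = q ^ 2 ->
  (forall X : line D, #|points_on X| <= q.+1) -> #|lines_through u| = q ->
  exists L L' : line D, [/\ inc u L, inc u L', L != L',
    #|points_on L| = q.+1 & #|points_on L'| = q.+1].
Proof.
move=> q3 hJ cD hs hu.
pose S := [set X in lines_through u | #|points_on X| <= q].
have cS : #|S| <= 1.
  have : \sum_(X in lines_through u) (#|points_on X|.-1 + (X \in S))
         <= \sum_(X in lines_through u) q.
    apply: leq_sum => X uX; rewrite inE uX /=.
    have : 0 < #|points_on X|.
      by apply/card_gt0P; exists u; move: uX; rewrite !inE.
    by have := hs X; case: (leqP #|points_on X| q); lia.
  rewrite big_split /= card_other_points // sum_nat_const hu cD.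
  suff -> : \sum_(X in lines_through u) (X \in S) = #|S| by nia.
  rewrite -sum1_card big_mkcond [RHS]big_mkcond; apply: eq_bigr => X _.
  by rewrite [in RHS]inE; rewrite !inE; case: (inc u X) => //=; case: (_ <= q).
have : 1 < #|lines_through u :\: S|.
  have := subset_leq_card (subsetIr (lines_through u) S).
  by have := cardsID S (lines_through u); lia.
move=> /card_gt1P[L [L' [hL hL' nLL']]]; exists L, L'.
move: hL hL'; rewrite !inE => /andP[h1 uL] /andP[h2 uL'].
move: h1 h2; rewrite uL uL' /= -!ltnNge => h1 h2; split=> //.
  by apply/eqP; rewrite eqn_leq hs.
by apply/eqP; rewrite eqn_leq hs.
Qed.

(** * The three cases *)

Section Cases.

Variables (D : geometry) (q : nat).
Hypotheses (hJ : joined D) (h2 : forall X : line D, 2 <= #|points_on X|).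
Hypotheses (hq : 3 <= q) (hcard : #|point D| = q ^ 2).
Hypothesis hdeg : forall p : point D, #|lines_through p| <= q.+1.
Hypothesis hsize : forall X : line D, #|points_on X| <= q.+1.

Let q2 : 2 <= q. Proof. exact: ltnW. Qed.

Let obtained : Prop :=
  exists (P : geometry) (Y : {set point P}),
    [/\ projective_plane_of_order q P, #|Y| = q.+1 & obtained_by_deleting D Y].

Lemma affine_case :
  (forall p : point D, #|lines_through p| = q.+1) ->
  (forall X : line D, #|points_on X| <> q.+1) -> obtained /\ case_a q D.
Proof.
move=> hd hno.
have sz_le (X : line D) : #|points_on X| <= q.
  by have := hsize X; rewrite leq_eqVlt => /orP[/eqP/hno|].
(* The [q + 1] lines through [p] have at most [q - 1] further points each and cover
   [q ^ 2 - 1 = (q + 1) * (q - 1)], so equality holds for each. *)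
have sz (X : line D) : #|points_on X| = q.
  apply/eqP; rewrite eqn_leq sz_le leqNgt; apply/negP => small.
  have /card_gt0P[p] : 0 < #|points_on X| by apply: leq_trans (h2 X).
  rewrite inE => pX; have := card_other_points hJ p; rewrite hcard.
  rewrite (bigD1 X) ?inE //=.
  have : \sum_(Z in lines_through p | Z != X) #|points_on Z|.-1
         <= \sum_(Z in lines_through p :\ X) q.-1.
    rewrite [X in _ <= X](eq_bigl
        (fun Z => (Z \in lines_through p) && (Z != X))).
      by apply: leq_sum => Z _; have := sz_le Z; lia.
    by move=> Z; rewrite !inE andbC.
  rewrite sum_nat_const.
  have := hd p; rewrite (cardsD1 X) inE pX add1n => -[->].
  by have := h2 X; nia.
have cL : #|line D| = q ^ 2 + q.
  have := flag_count [set: point D] [set: line D].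
  rewrite (eq_bigr (fun=> q)) => [|X _]; last by rewrite setTI sz.
  rewrite [RHS](eq_bigr (fun=> q.+1)) => [|p _]; last by rewrite setTI hd.
  by rewrite !sum_nat_const !cardsT hcard; nia.
split; last first.
  split=> //; first by case=> X /hno.
  split=> //; split.
  - by split=> //; exact/joinedP.
  (* The parallels of [X] through [p] number [q + 1 - q = 1]. *)
  - move=> p X pX; have /eqP := card_parallels_at hJ pX.
    rewrite sz hd -addn1 eqn_add2l => /cards1P[Z /setP hZ]; exists Z; split.
      by have := hZ Z; rewrite !inE eqxx => /and3P[].
    move=> Z' [pZ' dZ']; have := hZ Z'; rewrite !inE pZ' dZ' andbT.
    rewrite (_ : Z' != X) => [/esym/eqP //|].
    by apply: contraNneq pX => <-.
  - have /card_gt0P[X _] : 0 < #|line D| by rewrite cL; lia.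
    have /card_gt1P[a [b [aX bX nab]]] : 1 < #|points_on X| by apply: h2.
    have /card_gt0P[c] : 0 < #|~: points_on X|.
      by have := cardsC (points_on X); rewrite sz hcard; nia.
    move: aX bX; rewrite !inE => aX bX cX; exists (c |: [set a; b]); split.
      rewrite cardsU1 cards2 nab !inE negb_or.
      by rewrite !(contraNneq _ cX) // => ->.
    case=> Z /subsetP hZ.
    have zs z : z \in c |: [set a; b] -> inc z Z by move/hZ; rewrite inE.
    move/negP: cX; apply; rewrite (line_eq hJ nab aX bX (Z := Z)) ?zs //.
    + by rewrite !inE eqxx.
    + by rewrite !inE eqxx orbT.
    + by rewrite !inE eqxx !orbT.
(* The empty line supplies the missing line of the count; it becomes the line at infinity. *)
have hD' : near_plane q (add_line (set0 : {set point D})).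
  split=> /=.
  - by apply: joined_add_line; rewrite ?cards0.
  - by move=> p; rewrite card_lines_through_add_line inE hd addn0.
  - by rewrite card_option cL; lia.
  - by case=> [X|]; rewrite points_on_add_line ?cards0.
  - by rewrite hcard.
have [T [i [f [hP full fI finc]]]] := near_plane_completion hD'.
apply: (@embedding_obtained q D (Geometry i) f Some q2 hP full hcard fI).
- by move=> X X' [].
- by move=> p X; exact: (finc p (Some X)).
- exact: h2.
move=> [L|]; first by rewrite codom_f.
move=> _; rewrite (_ : [set _ | _] = set0) ?cards0 //.
by apply/setP => p; rewrite !inE /=; have /= <- := finc p None; rewrite inE.
Qed.

Lemma deficient_case (u : point D) :
  #|lines_through u| <= q -> obtained /\ case_b q D.
Proof.
move=> hu.
have {}hu : #|lines_through u| = q.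
  by apply/eqP; rewrite eqn_leq hu card_lines_through_ge.
have [L [L' [uL uL' nLL' hL hL']]] := two_full_lines hq hJ hcard hsize hu.
(* A point [p] other than [u] is off one of the two full lines, and is joined to its [q + 1] points
   by distinct lines. *)
have hd (p : point D) : p <> u -> #|lines_through p| = q.+1.
  move=> /eqP npu; apply/eqP; rewrite eqn_leq hdeg /=.
  have [pL|pL] := boolP (inc p L); last first.
    by rewrite -(card_parallels_at hJ pL) hL leq_addr.
  have pL' : ~~ inc p L'.
    by apply: contraNN nLL' => pL'; apply/eqP/(line_eq hJ npu).
  by rewrite -(card_parallels_at hJ pL') hL' leq_addr.
(* The line [{u}] raises the degree of [u] to [q + 1]; it becomes [W]. *)
pose D' := add_line [set u].
have hJ' : joined D' by apply: joined_add_line; rewrite ?cards1.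
have hd' (p : point D') : #|lines_through p| = q.+1.
  rewrite card_lines_through_add_line inE.
  by case: (eqVneq p u) => [->|/eqP/hd->]; rewrite ?hu ?addn1 ?addn0.
have cL' : #|line D'| = q ^ 2 + q + 1.
  apply: (@full_line_card_lines q D' (Some L) hJ' hd').
    by case=> [X|]; rewrite points_on_add_line ?cards1 // ltnW.
  by rewrite points_on_add_line.
have cL : #|line D| = q ^ 2 + q by move: cL'; rewrite card_option; lia.
have hD' : near_plane q D'.
  split=> //; last by rewrite /= hcard.
  by case=> [X|]; rewrite points_on_add_line ?cards1.
have [T [i [f [hP full fI finc]]]] := near_plane_completion hD'.
have SI : injective (@Some (line D)) by move=> X X' [].
have fincS (p : point D) X : inc p X = i (f p) (Some X).
  exact: (finc p (Some X)).
have onW (p : point D) : i (f p) None = (p == u).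
  by have /= <- := finc p None; rewrite inE.
split.
  apply: (@embedding_obtained q D (Geometry i) f Some q2 hP full hcard fI) => //.
  move=> [X|]; first by rewrite codom_f.
  move=> _; rewrite (_ : [set _ | _] = [set u]) ?cards1 //.
  by apply/setP => p; rewrite !inE -onW.
exists u; split=> //; first by rewrite hu.
pose P := Geometry i; pose W : line P := None.
have uW : @inc P (f u) W by rewrite /= onW.
have := card_missing_points q2 hP full hcard fI.
set Y := ~: _ => cY.
have WY : points_on W :\ f u \subset Y.
  apply/subsetP => x; rewrite !inE => /andP[nxu xW].
  apply: contraNN nxu => /imsetP[p _ xp]; move: xW.
  by rewrite xp /= onW => /eqP->.
(* Of the [q + 1] deleted points, [q] lie on [W]; [v] is the remaining one. *)
have /eqP/cards1P[v hv] : #|Y :\: (points_on W :\ f u)| = 1.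
  rewrite cardsD (setIidPr WY) cY -(full W) (cardsD1 (f u) (points_on W)).
  by rewrite inE uW addnK.
have : v \in Y :\: (points_on W :\ f u) by rewrite hv inE.
rewrite inE => /andP[vW vY].
exists P, W, v, f, Some; split=> //.
- exact: full_near_plane_projective.
- apply: contraNN vW => vW; rewrite !inE vW andbT.
  by apply: contraTneq vY => ->; rewrite inE negbK imset_f.
- split=> //; first split=> //.
    by rewrite -hv -{1}(setIidPr WY) setID setCK.
  split=> //; apply/setP => -[X|]; rewrite !inE.
    by apply/imsetP; exists X.
  by apply/imsetP => -[].
Qed.

Lemma regular_case (L : line D) :
  (forall p : point D, #|lines_through p| = q.+1) ->
  #|points_on L| = q.+1 -> obtained /\ case_c q D.
Proof.
move=> hd hL.
have cL : #|line D| = q ^ 2 + q + 1.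
  by apply: (full_line_card_lines hJ hd _ hL) => X; apply: ltnW.
have hD' : near_plane q D by split=> //; rewrite hcard.
have [T [i [f [hP full fI finc]]]] := near_plane_completion hD'.
split.
  apply: (@embedding_obtained q D (Geometry i) f id q2 hP full hcard fI) => //.
  by move=> X; rewrite (codom_f id X).
split=> //; pose P := Geometry i.
set Y : {set point P} := ~: [set f p | p : point D].
have fullP (X : line P) : #|points_on X| = q.+1 := full X.
have DX (X : line P) : #|@points_on D X| = #|points_on X :\: Y|.
  by rewrite -(@card_line_image D P f id fI finc X).
exists P, Y, f, id; split=> //.
- exact: full_near_plane_projective.
- exact: (@card_missing_points q D P f).
(* A line with [q] deleted points would keep at most one point in [D], against [h2]. *)
- move=> A AY cA [X AX].
  have /subset_leq_card : A \subset @points_on P X :&: Y.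
    by rewrite subsetI AX AY.
  have := fullP X; rewrite -(cardsID Y (points_on X)) cA.
  by have := h2 X; rewrite DX; lia.
- split=> //; first by rewrite setCK.
  by split=> //; apply/setP => X; rewrite inE; apply/imsetP; exists X.
- move=> y yY.
  case: (pickP (fun X : line D => @inc P y X && (#|points_on X| == q))).
    by move=> X /andP[yX /eqP cX]; exists X.
  move=> hno; exfalso.
  (* The [q + 1] lines through [y] partition the [q ^ 2] remaining points. Each has lost [y], so it
     keeps at most [q]; if none kept exactly [q], the total would be at most
     [(q + 1) * (q - 1) < q ^ 2]. *)
  have := flag_count (~: Y) (@lines_through P y).
  rewrite [RHS](eq_bigr (fun=> 1)) => [|x xY]; last first.
    case: hP => hJP _ _ _ _; rewrite hJP //.
    by apply: contraTneq xY => <-; rewrite inE yY.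
  have cY : #|~: Y| = q ^ 2.
    by rewrite setCK card_imset // -hcard; exact: eq_card.
  rewrite sum_nat_const cY muln1 => flags.
  have : \sum_(X in @lines_through P y) #|~: Y :&: points_on X|
         <= \sum_(X in @lines_through P y) q.-1.
    apply: leq_sum => X; rewrite inE setIC -setDE => yX.
    have nq : #|points_on X :\: Y| <> q.
      by move=> cX; have := hno X; rewrite yX /= DX cX eqxx.
    have := fullP X; rewrite -(cardsID Y (points_on X)).
    have : 0 < #|points_on X :&: Y|.
      by apply/card_gt0P; exists y; rewrite !inE yX -in_setC.
    by lia.
  rewrite flags sum_nat_const; case: hP => _ -> _ _ _.
  by move: hq; nia.
Qed.

End Cases.

Theorem theorem1p7 (D : geometry) (q : nat)
    (hD : linear_space D)
    (hq : 3 <= q)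
    (hcard : #|point D| = q ^ 2)
    (hdeg : forall p : point D, #|lines_through p| <= q.+1)
    (hsize : forall X : line D, #|points_on X| <= q.+1) :
  (exists (P : geometry) (Y : {set point P}),
      [/\ projective_plane_of_order q P,
          #|Y| = q.+1
        & obtained_by_deleting D Y])
  /\ [\/ case_a q D, case_b q D | case_c q D].
Proof.
have [/joinedP hJ h2] := hD.
case: (pickP (fun u : point D => #|lines_through u| <= q)) => [u hu|hno].
  have [hP hb] := deficient_case hJ h2 hq hcard hdeg hsize hu.
  by split=> //; apply: Or32.
have hd (p : point D) : #|lines_through p| = q.+1.
  by apply/eqP; rewrite eqn_leq hdeg ltnNge hno.
case: (pickP (fun X : line D => #|points_on X| == q.+1)) => [L /eqP hL|hfull].
  have [hP hc] := regular_case hJ h2 hq hcard hsize hd hL.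
  by split=> //; apply: Or33.
have [|hP ha] := affine_case hJ h2 hq hcard hsize hd.
  by move=> X /eqP; rewrite hfull.
by split=> //; apply: Or31.
Qed.
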